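(* Let $I$ be an arbitrary (possibly uncountable) index set and let $X_\alpha=[0,1]$ for every $\alpha\in I$. For every $\alpha\in I$, let $T_\alpha$ be an upper semicontinuous multi-valued map from $\prod_{\lambda\in I}X_\lambda$ into $X_\alpha$ such that each value $T_\alpha(x)$ is either empty or a nonempty closed convex set, and such that $\mathrm{Dom}(T_\alpha)$ is perfectly normal. Then there exists $x=(x_\lambda)_{\lambda\in I}\in\prod_{\lambda\in I}X_\lambda$ such that for every $\alpha\in I$, either $x_\alpha\in T_\alpha(x)$ or $T_\alpha(x)=\emptyset$.
   Context: $[0,1]$ is the unit real interval with its usual topology, the product carries the product topology, and subsets are endowed with the induced topology. A multi-valued map $T$ from a space $E_1$ into a space $E_2$ assigns to each $x\in E_1$ a (possibly empty) subset $T(x)\subset E_2$; $\mathrm{Dom}(T)=\{x\in E_1 : T(x)\neq\emptyset\}$. The map $T$ is upper semicontinuous if for every $x_0\in E_1$ and every open subset $V$ of $E_2$ (including $V=\emptyset$) with $T(x_0)\subset V$ there is a neighborhood $O$ of $x_0$ in $E_1$ such that $T(x)\subset V$ for all $x\in O$. A separated (Hausdorff) space is perfectly normal if each of its closed subsets is a $G_\delta$-set, i.e. a countable intersection of open sets. *)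

(* Defs.v *)
From HB Require Import structures.
From mathcomp Require Import all_boot all_order all_algebra.
From mathcomp Require Import all_classical all_reals all_analysis.
From mathcomp Require Import borel_hierarchy.

Set Implicit Arguments.
Unset Strict Implicit.
Unset Printing Implicit Defensive.

Import Order.TTheory GRing.Theory Num.Theory.
Import numFieldNormedType.Exports.

Local Open Scope classical_set_scope.
Local Open Scope ring_scope.

(* A multi-valued map from E1 to E2 is a function E1 -> set E2; its values may
   be empty. *)
Definition Dom (E1 E2 : Type) (T : E1 -> set E2) : set E1 :=
  [set x | T x !=set0].

(* V may be set0: near a point with empty value, all values are empty. *)
Definition upper_semicontinuous (E1 E2 : topologicalType) (T : E1 -> set E2) :=
  forall (x0 : E1) (V : set E2), open V -> T x0 `<=` V ->
    \forall x \near x0, T x `<=` V.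

(* Normality itself is not required: only Hausdorff, and every closed set is a
   G_delta. *)
Definition perfectly_normal (X : topologicalType) :=
  hausdorff_space X /\ forall F : set X, closed F -> Gdelta F.

Definition unit_interval (R : realType) : topologicalType :=
  set_type (`[0, 1] : set R).

(* There is no convex structure on the subtype [0, 1] itself: convexity is that
   of the image in R. *)
Definition convex_in_unit_interval (R : realType) (A : set (unit_interval R)) :=
  convex_set (set_val @` A : set (convex_lmodType R^o)).

Definition cube (R : realType) (I : Type) : topologicalType :=
  prod_topology (fun _ : I => unit_interval R).

(* Main.v *)
Require Import Defs.
From mathcomp Require Import all_boot all_order all_algebra all_fingroup finmap.
From mathcomp Require Import all_classical all_reals all_analysis.
From mathcomp Require Import borel_hierarchy.
From mathcomp Require Import zify ring lra.

Set Implicit Arguments.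
Unset Strict Implicit.
Unset Printing Implicit Defensive.

Import Order.TTheory GRing.Theory Num.Theory.
Import numFieldNormedType.Exports.

Local Open Scope ring_scope.

(**
  The domain D of T_i is closed (take V empty in upper semicontinuity).  On D,
  the points having a value below x_i, resp. above x_i, form closed sets L and
  M covering D, and L /\ M is the set where x_i lies in T_i(x), by convexity.
  Perfect normality makes D \ L and D \ M separated F_sigma sets, so they
  extend to disjoint open subsets of the cube.  The complements of these two
  sets cover the cube, and it remains to find a point common to all of them:
  this is the Poincare-Miranda theorem in an infinite cube, which follows from
  the finite-dimensional one by compactness.

  The finite-dimensional case rests on Kuhn's lemma on 0/1 labels g_1, ..., g_n
  of the grid {0, ..., k}^n.  It is proved by summing, over all simplices of the
  Kuhn triangulation of the torus (Z/(k+1))^n, the cup product of the 1-cochains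
  d(g_j) + (j-th wrap-around class) in characteristic 2.  By Stokes the sum does
  not depend on the labels, and without labels it has a single nonzero term.
*)

(** * Cancellation in characteristic 2 and an abstract Stokes formula *)

Section CharacteristicTwo.
Variables (F : comNzRingType) (charF2 : 2%N \in [pchar F]).

Lemma addxx (x : F) : x + x = 0.
Proof. exact: (addrr_pchar2 charF2). Qed.

Lemma eq_char2 (x y : F) : x + y = 0 -> x = y.
Proof. by move=> /eqP; rewrite addr_eq0 => /eqP->; rewrite -[LHS]addr0 -(addxx y) addKr. Qed.

(** The two members of each orbit of [f] contribute equal terms, which cancel; comparing [enum_rank]
    picks one member per orbit. *)
Lemma sum_involution_char2 (S : finType) (f : S -> S) (X : S -> F) :
  involutive f -> (forall s, f s != s) -> (forall s, X (f s) = X s) ->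
  \sum_s X s = 0.
Proof.
move=> fK fN Xf.
pose lo s := (enum_rank s < enum_rank (f s))%N.
have loN s : lo (f s) = ~~ lo s.
  rewrite /lo fK -leqNgt [RHS]leq_eqVlt orb_idl // => /eqP /val_inj /enum_rank_inj E.
  by case/eqP: (fN s).
rewrite (bigID lo) /= [X in _ + X](reindex_inj (inv_inj fK)) /=.
by rewrite [X in _ + X](eq_big lo X) ?addxx // => s; rewrite loN negbK.
Qed.

Section Stokes.
Variables (S : finType) (n : nat).
Variables (swap : nat -> S -> S) (rot : S -> S).
Hypothesis swapK : forall m, (0 < m < n)%N -> involutive (swap m).
Hypothesis swapN : forall m, (0 < m < n)%N -> forall s, swap m s != s.
Hypothesis rotI : injective rot.

(** [Y s l] stands for a value at the [l]-th vertex of [s], and [swap m s] for the neighbour of [s]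
    across the face opposite vertex [m]. *)
Definition swap_inv (Y : S -> nat -> F) := forall s m l,
  (0 < m < n)%N -> l != m -> Y (swap m s) l = Y s l.

Variables (G : nat -> S -> nat -> F) (H : S -> nat -> F).
Hypothesis G_swap : forall j, swap_inv (G j).
Hypothesis H_swap : swap_inv H.
Let D j s m := G j s m.+1 + G j s m.
(** Stated on differences because a function on the universal cover may shift by a constant when the
    base vertex moves. *)
Hypothesis D_rot : forall j s m, (m.+1 < n)%N -> D j (rot s) m = D j s m.+1.
Hypothesis H_rot : forall s m, (m < n)%N -> H (rot s) m = H s m.+1.

(* With the other cochains closed, the coboundary of [H] cup the rest is a sum
   over faces: an inner face is shared by a simplex and its swap, an outer one
   by a simplex and its rotation, so everything cancels in characteristic 2. *)
Lemma stokes i : (i < n)%N ->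
  \sum_s (\prod_(0 <= j < i) D j s j) * (H s i.+1 + H s i) *
         (\prod_(i.+1 <= j < n) D j s j) = 0.
Proof.
move=> ltin.
(* [A m] and [B m] skip the edge from vertex [m] to vertex [m.+1]. [A i] and [B i] are the two
   halves of the summand; [A n.-1] lives on the face without the last vertex, [B 0] on the face
   without the first. *)
pose A m s := (\prod_(0 <= j < i) D j s j) * H s i *
  ((\prod_(i.+1 <= j < m.+1) D j s j.-1) * (\prod_(m.+1 <= j < n) D j s j)).
pose B m s := (\prod_(0 <= j < m) D j s j) * (\prod_(m <= j < i) D j s j.+1) *
  (H s i.+1 * (\prod_(i.+1 <= j < n) D j s j)).
have DswapF m j s l : (0 < m < n)%N -> l != m -> l.+1 != m -> D j (swap m s) l = D j s l.
  by move=> mn lm lm1; rewrite /D !G_swap.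
have DD j s m : D j s m + D j s m.+1 = G j s m.+2 + G j s m.
  by rewrite /D addrC addrA -[X in X + _]addrA addxx addr0.
have stepA m : (i <= m)%N -> (m.+1 < n)%N -> \sum_s A m s = \sum_s A m.+1 s.
  move=> im mn; apply: eq_char2; rewrite -big_split /=.
  have mn' : (0 < m.+1 < n)%N by [].
  apply: (sum_involution_char2 (swapK mn') (swapN mn')) => s.
  (* By [DD] the two terms add up to an expression that avoids vertex [m.+1], hence is invariant
     under [swap m.+1]. *)
  have E s' : A m s' + A m.+1 s' =
    (\prod_(0 <= j < i) D j s' j) * H s' i *
    ((\prod_(i.+1 <= j < m.+1) D j s' j.-1) * (\prod_(m.+2 <= j < n) D j s' j)) *
    (G m.+1 s' m.+2 + G m.+1 s' m).
    rewrite -DD /A [X in _ * (_ * X) + _]big_ltn // [X in _ + _ * (X * _)]big_nat_recr //=.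
    by ring.
  rewrite !E !G_swap ?H_swap //; try lia.
  congr (_ * _ * (_ * _) * _); apply: eq_big_nat => j jb; apply: DswapF => //; lia.
have stepB m : (0 < m)%N -> (m <= i)%N -> \sum_s B m s = \sum_s B m.-1 s.
  case: m => // m _ mi; apply: eq_char2; rewrite -big_split /=.
  have mn' : (0 < m.+1 < n)%N by lia.
  apply: (sum_involution_char2 (swapK mn') (swapN mn')) => s.
  have E s' : B m.+1 s' + B m s' =
    (\prod_(0 <= j < m) D j s' j) * (\prod_(m.+1 <= j < i) D j s' j.+1) *
    (H s' i.+1 * (\prod_(i.+1 <= j < n) D j s' j)) *
    (G m s' m.+2 + G m s' m).
    rewrite -DD /B [X in X * _ * _ + _]big_nat_recr //= [X in _ + _ * X * _]big_ltn //.
    by ring.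
  rewrite !E !G_swap ?H_swap //; try lia.
  congr (_ * _ * (_ * _) * _); apply: eq_big_nat => j jb; apply: DswapF => //; lia.
have allA : \sum_s A i s = \sum_s A n.-1 s.
  have K d : (i + d < n)%N -> \sum_s A i s = \sum_s A (i + d)%N s.
    elim: d => [|d IH] Hd; first by rewrite addn0.
    by rewrite addnS -stepA ?IH //; lia.
  have -> : n.-1 = (i + (n.-1 - i))%N by lia.
  apply: K; lia.
have allB : \sum_s B i s = \sum_s B 0%N s.
  have K d : (d <= i)%N -> \sum_s B d s = \sum_s B 0%N s.
    by elim: d => [//|d IH] Hd; rewrite stepB ?IH //; lia.
  exact: K.
transitivity (\sum_s B i s + \sum_s A i s).
  rewrite -big_split /=; apply: eq_bigr => s _.
  by rewrite /A /B (big_geq (leqnn i)) (big_geq (leqnn i.+1)); ring.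
rewrite allA allB; suff -> : \sum_s B 0%N s = \sum_s A n.-1 s by rewrite addxx.
(* The face of [rot s] without its last vertex is the face of [s] without its first. *)
rewrite [RHS](reindex_inj rotI) /=.
apply: eq_bigr => s _; rewrite /A /B H_rot // prednK; last by lia.
rewrite [in RHS](big_geq (leqnn n)) mulr1 [in LHS]big_geq // mul1r mulrA.
congr (_ * _ * _); apply: eq_big_nat => j jb; rewrite D_rot; try lia; congr D; lia.
Qed.
End Stokes.

(** * The cup product on the Kuhn triangulation of the torus *)

Section Torus.
Variables (n' k : nat).
Hypothesis k_gt0 : (0 < k)%N.
Local Notation n := n'.+1.
Local Notation torus := {ffun 'I_n -> 'I_k.+1}.
Local Notation simplex := (torus * {perm 'I_n})%type.
Implicit Types (s : simplex).

(* The simplex (v, p) has vertices u_m, 0 <= m <= n, where u_m raises, modulo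
   k + 1, the coordinates x of v with p x < m. *)
Definition vertex s (m : nat) : torus := [ffun x => inord ((s.1 x + (s.2 x < m)%N) %% k.+1)].

(* Turns the j-th label into a function on the universal cover that jumps by 1
   when the j-th coordinate wraps around; its coboundary is closed on the torus
   but not exact. *)
Definition carry (j : nat) s (m : nat) : F :=
  ((s.1 (inord j) == k :> nat) && (s.2 (inord j) < m)%N)%:R.

(** Exchanging two consecutive steps changes only the vertex between them. *)
Definition swap_steps m s : simplex := (s.1, (s.2 * tperm (inord m.-1) (inord m))%g).

Lemma swap_steps_lt m s x l : (0 < m < n)%N -> l != m ->
  ((swap_steps m s).2 x < l)%N = (s.2 x < l)%N.
Proof.
move=> mn lm; rewrite /= permM; case: tpermP => [->|->|//]; rewrite !inordK; lia.
Qed.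

Lemma swap_stepsK m : (0 < m < n)%N -> involutive (swap_steps m).
Proof. by move=> _ [v p]; rewrite /swap_steps /= -mulgA tperm2 mulg1. Qed.

Lemma swap_steps_neq m : (0 < m < n)%N -> forall s, swap_steps m s != s.
Proof.
move=> mn [v p]; apply/eqP => -[] /(congr1 (fun q : {perm 'I_n} => q ((p^-1)%g (inord m)))).
rewrite permM permKV tpermR => /(congr1 val) /=; rewrite !inordK; lia.
Qed.

(** Drops the first vertex and appends a new last one: the step that [s] takes first is now taken
    last. *)
Definition rotate s : simplex :=
  (vertex s 1, (s.2 * perm (@ord_pred_inj n))%g).

Lemma rotate_val s x :
  (rotate s).2 x = (if s.2 x == 0%N :> nat then n' else (s.2 x).-1) :> nat.
Proof.
rewrite /= permM permE /=; case: (s.2 x) => -[|y] /= ly; first by rewrite modn_small.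
by rewrite modnDr modn_small //; lia.
Qed.

Lemma rotate_inj : injective rotate.
Proof.
case=> v p [w q]; rewrite /rotate => E.
have {}E2 : p = q by apply: (mulIg (perm (@ord_pred_inj n))); exact: (congr1 snd E).
have {E} := congr1 fst E; rewrite /= {}E2 => E.
congr pair; apply/ffunP => x; move/ffunP/(_ x): E; rewrite !ffunE /=.
move/(congr1 val); rewrite /= !inordK ?ltn_pmod // => /eqP; rewrite eqn_modDr !modn_small //.
by move=> /eqP /val_inj.
Qed.

Lemma vertex_rotate s m : (m < n)%N -> vertex (rotate s) m = vertex s m.+1.
Proof.
move=> mn; apply/ffunP => x; rewrite !ffunE rotate_val /= inordK ?ltn_pmod //.
rewrite modnDml; congr (inord (_ %% _)); case: (s.2 x) => -[|y] ly /=; lia.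
Qed.

Lemma vertex_swap_steps s m l : (0 < m < n)%N -> l != m -> vertex (swap_steps m s) l = vertex s l.
Proof. by move=> mn lm; apply/ffunP => x; rewrite !ffunE swap_steps_lt. Qed.

Lemma carry_swap_steps j : swap_inv n swap_steps (carry j).
Proof. by move=> s m l mn lm; rewrite /carry swap_steps_lt. Qed.

Lemma carry_rotate j s m : (m.+1 < n)%N ->
  carry j (rotate s) m.+1 + carry j (rotate s) m = carry j s m.+2 + carry j s m.+1.
Proof.
move=> mn; rewrite /carry rotate_val /= ffunE inordK ?ltn_pmod //.
set x := inord j; have := ltn_ord (s.1 x); rewrite ltnS => vk.
have := ltn_ord (s.2 x).
case: (s.2 x) => -[|y] _ /= ly.
  have [-> ->] : (n' < m.+1)%N = false /\ (n' < m)%N = false by lia.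
  by rewrite !andbF !addxx.
by rewrite addn0 modn_small // !ltnS.
Qed.

Variable g : nat -> torus -> F.

(* The labels below [i] have been dropped, leaving the bare carry. *)
Definition cochain (i j : nat) s (m : nat) : F :=
  carry j s m + (if (j < i)%N then 0 else g j (vertex s m)).

Definition coboundary i j s m := cochain i j s m.+1 + cochain i j s m.

(** The two products differ only in the factor [i], by the coboundary of the label [g i]. This label
    is a genuine function on the torus, so [stokes] applies with it as [H]. *)
Lemma cup_step i : (i < n)%N ->
  \sum_s \prod_(0 <= j < n) coboundary i j s j =
  \sum_s \prod_(0 <= j < n) coboundary i.+1 j s j.
Proof.
move=> ltin; apply: eq_char2; rewrite -big_split /=.
have gswap j : swap_inv n swap_steps (fun s m => g j (vertex s m)).
  by move=> s m l mn lm; rewrite vertex_swap_steps.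
rewrite -[RHS](@stokes _ n swap_steps rotate swap_stepsK swap_steps_neq rotate_inj (cochain i)
   (fun s m => g i (vertex s m)) _ _ _ _ i ltin) //; first last.
- by move=> s m mn; rewrite vertex_rotate.
- move=> j s m mn; rewrite /cochain.
  rewrite addrACA carry_rotate // -[RHS]addrACA; case: ifP => // _.
  by rewrite !vertex_rotate //; lia.
- move=> j s m l mn lm; rewrite /cochain carry_swap_steps //; case: ifP => // _.
  by rewrite vertex_swap_steps.
apply: eq_bigr => s _.
have spl X : \prod_(0 <= j < n) X j =
  (\prod_(0 <= j < i) X j) * (X i * \prod_(i.+1 <= j < n) X j) :> F.
  by rewrite -big_ltn // -big_cat_nat //= ltnW.
rewrite !spl.
have -> : \prod_(0 <= j < i) coboundary i.+1 j s j = \prod_(0 <= j < i) coboundary i j s j.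
  apply: eq_big_nat => j jb; rewrite /coboundary /cochain.
  by have [-> ->] : (j < i)%N /\ (j < i.+1)%N by lia.
have -> : \prod_(i.+1 <= j < n) coboundary i.+1 j s j = \prod_(i.+1 <= j < n) coboundary i j s j.
  apply: eq_big_nat => j jb; rewrite /coboundary /cochain.
  by have [-> ->] : (j < i)%N = false /\ (j < i.+1)%N = false by lia.
rewrite -/(coboundary i _ s _) -mulrA -mulrDr -mulrDl; congr (_ * (_ * _)).
rewrite /coboundary /cochain ltnn ltnSn !addr0.
move: (carry _ _ _) (carry _ _ _) (g _ _) (g _ _) => a b c d.
by transitivity (d + c + ((a + b) + (a + b))); [ring | rewrite addxx addr0].
Qed.

(** Factor [j] is nonzero exactly when coordinate [j] wraps around at step [j]. Only [w], based at
    the corner with all coordinates [k] and raising the coordinates in their order, survives. *)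
Lemma cup_carry : \sum_s \prod_(0 <= j < n) coboundary n j s j = 1.
Proof.
pose w : simplex := ([ffun=> ord_max], 1%g).
have E s : \prod_(0 <= j < n) coboundary n j s j = (s == w)%:R.
  transitivity (\prod_(j < n) (((s.1 j == k :> nat) && (s.2 j == j))%:R : F)).
    rewrite big_mkord; apply: eq_bigr => j _.
    rewrite /coboundary /cochain ltn_ord !addr0 /carry inord_val.
    case: (_ == k) => /=; last by rewrite addr0.
    rewrite -val_eqE /= ltnS.
    by case: ltngtP => _; [exact: addxx|exact: addr0|exact: addr0].
  have [->|ne] := eqVneq s w.
    by rewrite big1 // => j _; rewrite /= ffunE perm1 !eqxx.
  have /existsP[j /negPf Hj] : [exists j, ~~ ((s.1 j == k :> nat) && (s.2 j == j))].
    rewrite -negb_forall; apply: contraNN ne => /forallP all; apply/eqP.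
    case: s all => v p all; congr pair; [apply/ffunP => x|apply/permP => x];
      case/andP: (all x) => /= /eqP a /eqP b; rewrite ?ffunE ?perm1 //.
    exact: val_inj.
  by rewrite (bigD1 j) //= Hj mul0r.
rewrite (eq_bigr _ (fun s _ => E s)) (bigD1 w) //= eqxx.
by rewrite big1 ?addr0 // => s /negPf ->.
Qed.

Lemma cup_neq0 : exists s, forall j, (j < n)%N -> coboundary 0 j s j != 0.
Proof.
have K d : (d <= n)%N -> \sum_s \prod_(0 <= j < n) coboundary 0 j s j =
    \sum_s \prod_(0 <= j < n) coboundary d j s j.
  by elim: d => [_|d IH dn]; [reflexivity | exact: etrans (IH (ltnW dn)) (cup_step dn)].
have S1 := etrans (K n (leqnn n)) cup_carry.
have /existsP[s Hs] : [exists s, \prod_(0 <= j < n) coboundary 0 j s j != 0].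
  apply: contra_eqT S1; rewrite negb_exists => /forallP all0.
  rewrite big1 1?eq_sym ?oner_eq0 // => s _; apply/eqP; exact: negbNE (all0 s).
exists s => j jn; apply: contraNneq Hs => z; rewrite (@big_cat_nat _ _ _ j) ?(ltnW jn) //=.
by rewrite [X in _ * X]big_ltn // z mul0r mulr0.
Qed.
End Torus.
End CharacteristicTwo.

(** * Kuhn's lemma on the grid *)

(** A simplex with nonzero cup product wraps in no direction, by the boundary conditions, so it lies
    in one cell of the grid; there the factor [j] says that label [j] differs between vertices [j]
    and [j.+1]. *)
Lemma kuhn (n k : nat) (g : 'I_n -> ('I_n -> nat) -> bool) : (0 < k)%N ->
  (forall j y, (forall i, y i <= k)%N -> y j = 0%N -> ~~ g j y) ->
  (forall j y, (forall i, y i <= k)%N -> y j = k -> g j y) ->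
  exists v : 'I_n -> nat, (forall i, v i < k)%N /\
    forall j, exists p q : 'I_n -> nat,
      [/\ forall i, (v i <= p i <= (v i).+1)%N,
          forall i, (v i <= q i <= (v i).+1)%N, ~~ g j p & g j q].
Proof.
move=> k0 g0 g1; case: n g g0 g1 => [|n'] g g0 g1; first by exists (fun=> 0%N); split; case.
have [F charF2] : exists F : comNzRingType, 2%N \in [pchar F].
  by exists 'F_2; exact: (pchar_Fp (isT : prime 2)).
pose lab (j : nat) (y : {ffun 'I_n'.+1 -> 'I_k.+1}) : F := (g (inord j) (fun i => val (y i)))%:R.
have [[v p] Hs] := cup_neq0 charF2 k0 lab.
have yk (y : {ffun 'I_n'.+1 -> 'I_k.+1}) i : (val (y i) <= k)%N by exact: leq_ord.
(* In a simplex wrapping in direction j, label plus carry is constantly 1. *)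
have vk j : (v j < k)%N.
  rewrite ltn_neqAle -ltnS ltn_ord andbT; apply/negP => /eqP vjk.
  have /eqP[] := Hs j (ltn_ord j).
  suff E m : cochain lab 0 j (v, p) m = 1 by rewrite /coboundary !E (addxx charF2).
  rewrite /cochain /carry /lab ltn0 inord_val /= vjk eqxx /=.
  have yE : val (vertex (v, p) m j) = if (p j < m)%N then 0%N else k.
    rewrite ffunE /= vjk inordK ?ltn_pmod //; case: (p j < m)%N; first by rewrite addn1 modnn.
    by rewrite addn0 modn_small.
  case: ifP yE => lt E.
    by rewrite (negPf (g0 j _ (yk (vertex (v, p) m)) E)) addr0.
  by rewrite (g1 j _ (yk (vertex (v, p) m)) E) add0r.
exists (fun i => val (v i)); split=> // j.
have bd m i : (v i <= val (vertex (v, p) m i) <= (v i).+1)%N.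
  rewrite ffunE /= inordK ?ltn_pmod // modn_small; last by have := vk i; lia.
  lia.
have := Hs j (ltn_ord j); rewrite /coboundary /cochain /carry inord_val /= (ltn_eqF (vk j)) /=.
rewrite !add0r /lab inord_val.
set a := vertex _ j.+1; set b := vertex _ j.
case Ea: (g j (fun i => val (a i))); case Eb: (g j (fun i => val (b i))); rewrite ?(addxx charF2) ?eqxx // => _.
  by exists (fun i => val (b i)), (fun i => val (a i)); split; [exact: bd|exact: bd|rewrite Eb|].
by exists (fun i => val (a i)), (fun i => val (b i)); split; [exact: bd|exact: bd|rewrite Ea|].
Qed.

Local Open Scope classical_set_scope.

(** * Compactness and the Poincare-Miranda theorem in finite dimension *)

Lemma compact_fip (X : topologicalType) (I : choiceType) (C : I -> set X) :
  compact [set: X] -> (forall i, closed (C i)) ->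
  (forall J : {fset I}, exists x, forall i, i \in J -> C i x) ->
  exists x, forall i, C i x.
Proof.
move=> cX clC fin; pose B (J : {fset I}) := [set x | forall i, i \in J -> C i x].
have PF : ProperFilter (filter_from [set: {fset I}] B).
  apply: filter_from_proper; last by move=> J _; case: (fin J) => x; exists x.
  apply: filter_from_filter; first by exists fset0.
  move=> J K _ _; exists (J `|` K)%fset => // x Bx.
  by split=> i iJ; apply: Bx; rewrite in_fsetU iJ ?orbT.
have [|x [_ clx]] := cX _ PF; first by exists fset0.
exists x => i; apply: clC => W Wx; apply: clx => //.
by exists [fset i]%fset => // y; apply; rewrite in_fset1.
Qed.

(** Grids of mesh [1 / (k + 1)] give points [z k] within the mesh of every [A j] and every [B j]; a
    cluster point lies in all of them. *)
Lemma poincare_miranda_rV (R : realType) (n : nat) (A B : 'I_n -> set 'rV[R]_n) :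
  (forall j, closed (A j)) -> (forall j, closed (B j)) ->
  (forall j x, A j x \/ B j x) ->
  (forall j (x : 'rV[R]_n), (forall i, 0 <= x ord0 i <= 1) -> x ord0 j = 0 -> B j x) ->
  (forall j (x : 'rV[R]_n), (forall i, 0 <= x ord0 i <= 1) -> x ord0 j = 1 -> A j x) ->
  exists x, forall j, A j x /\ B j x.
Proof.
move=> clA clB AB B0 A1.
pose pt k (y : 'I_n -> nat) : 'rV[R]_n := \row_i ((y i)%:R / k.+1%:R).
have pt_box k y : (forall i, y i <= k.+1)%N -> forall i, 0 <= pt k y ord0 i <= 1.
  move=> yk i; rewrite mxE divr_ge0 ?ler0n //=.
  by rewrite ler_pdivrMr ?ltr0Sn // mul1r ler_nat.
have dist k (v p : 'I_n -> nat) : (forall i, v i <= p i <= (v i).+1)%N ->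
    forall i, `|pt k v ord0 i - pt k p ord0 i| <= k.+1%:R^-1.
  move=> vp i; rewrite !mxE -mulrBl normrM normfV (ger0_norm (ler0n _ _)).
  rewrite ler_piMl ?invr_ge0 ?ler0n // distrC.
  have /andP[v1 v2] := vp i.
  by rewrite -natrB // ger0_norm ?ler0n // lern1 leq_subLR addn1.
have appr k : exists z : 'rV[R]_n, (forall i, 0 <= z ord0 i <= 1) /\
    forall j, (exists2 p, A j p & forall i, `|z ord0 i - p ord0 i| <= k.+1%:R^-1) /\
              (exists2 p, B j p & forall i, `|z ord0 i - p ord0 i| <= k.+1%:R^-1).
  (* Label 1 means membership in [A j], but [A j] may meet the face where coordinate [j] is 0, so
     the label is forced to 0 there; on that face [B0] still gives [B j]. *)
  pose g j (y : 'I_n -> nat) := (y j != 0%N) && `[< A j (pt k y) >].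
  have [||v [vk Hv]] := @kuhn n k.+1 g (ltn0Sn _).
  - by move=> j y _ y0; rewrite /g y0.
  - move=> j y yk yj; rewrite /g yj /=; apply/asboolP; apply: A1; first exact: pt_box.
    by rewrite mxE yj divff.
  exists (pt k v); split; first by apply: pt_box => i; exact: ltnW.
  move=> j; have [p [q [vp vq gp gq]]] := Hv j; split.
    by exists (pt k q); [case/andP: gq => _ /asboolP | exact: dist].
  exists (pt k p); last exact: dist.
  move: gp; rewrite negb_and negbK => /orP[/eqP p0|/asboolP NA]; last by case: (AB j (pt k p)).
  apply: B0; last by rewrite mxE p0 mul0r.
  by apply: pt_box => i; have /andP[_] := vp i => /leq_trans; apply.
have [z zP] := choice appr.
have cbox : compact [set v : 'rV[R]_n | forall i, `[0, 1]%classic (v ord0 i)].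
  by apply: (@rV_compact R n (fun=> `[0, 1]%classic)) => i; exact: segment_compact.
have [|x [_ clx]] := cbox (z @ \oo) _.
  by exists 0%N => // k _ i; rewrite /= in_itv /=; case: (zP k).
have lim (C : set 'rV[R]_n) : closed C ->
    (forall k, exists2 p, C p & forall i, `|z k ord0 i - p ord0 i| <= k.+1%:R^-1) -> C x.
  move=> clC HC; apply: clC => W /nbhs_ballP[e /= e0 eW].
  have e20 : 0 < e / 2 by rewrite divr_gt0.
  have [K _ HK] := near_infty_natSinv_lt (PosNum e20).
  have [_ [[k Kk <-] zk]] : ([set z k | k in [set k | (K <= k)%N]] `&` ball x (e / 2)) !=set0.
    apply: clx; last exact: nbhsx_ballx.
    by exists K => // k Kk; exists k.
  have [p Cp zp] := HC k; exists p; split=> //; apply: eW.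
  rewrite (splitr e); apply: (ball_triangle zk); split=> // i j.
  rewrite (ord1 i) /ball /=; apply: le_lt_trans (zp j) _; exact: HK.
by exists x => j; split; [apply: lim (clA j) _ | apply: lim (clB j) _] => k;
  case: (zP k) => _ /(_ j) [].
Qed.

(** * Topology of the infinite cube and Poincare-Miranda there *)

Section Cube.
Variable R : realType.

Lemma clamp_subproof (t : R) : Num.max 0 (Num.min t 1) \in (`[0, 1]%classic : set R).
Proof. by rewrite inE /= in_itv /= le_max lexx /= ge_max ler01 /= ge_min lexx orbT. Qed.

Definition clamp (t : R) : unit_interval R := 
  exist (fun u => u \in (`[0, 1]%classic : set R)) _ (clamp_subproof t).

Lemma val_clamp t : 0 <= t <= 1 -> set_val (clamp t) = t.
Proof. by move=> /andP[t0 t1]; rewrite /= set_valE /= min_l // max_r. Qed.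

Lemma unit_intervalP (u : unit_interval R) : 0 <= set_val u <= 1.
Proof. by case: u => u uI; move: (set_mem uI); rewrite set_valE /= in_itv. Qed.

Lemma set_val_continuous : continuous (set_val : unit_interval R -> R).
Proof. exact: initial_continuous. Qed.

Lemma clamp_continuous : continuous clamp.
Proof.
apply: (@continuous_comp_initial _ R R (set_val : (`[0, 1]%classic : set R) -> R) clamp).
have -> : set_val \o clamp = cst 0 \max (id \min cst 1) by [].
move=> t; apply: continuous_max; first exact: cst_continuous.
by apply: continuous_min; [exact: id | exact: cst_continuous].
Qed.

Lemma unit_interval_compact : compact [set: unit_interval R].
Proof.
have -> : [set: unit_interval R] = clamp @` `[0, 1]%classic.
  apply/seteqP; split=> // u _; exists (set_val u); first by rewrite /= in_itv; exact: unit_intervalP.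
  by apply: val_inj; exact: (val_clamp (unit_intervalP u)).
apply: continuous_compact; last exact: segment_compact.
by apply: continuous_subspaceT; exact: clamp_continuous.
Qed.

Lemma unit_interval_hausdorff : hausdorff_space (unit_interval R).
Proof.
move=> u w clu; apply: val_inj; apply: (@Rhausdorff R) => A B Au Bw.
have [y [Ay By]] := clu _ _ (set_val_continuous Au) (set_val_continuous Bw).
by exists (set_val y).
Qed.

Lemma cube_compact (I : eqType) : compact [set: cube R I].
Proof.
have -> : [set: cube R I] = [set f | forall i, [set: unit_interval R] (f i)] by apply/seteqP.
by apply: (@tychonoff I (fun=> unit_interval R) (fun=> setT)) => _; exact: unit_interval_compact.
Qed.

Lemma cube_normal (I : eqType) : normal_space (cube R I).
Proof.
apply: compact_normal; last exact: cube_compact.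
by apply: (@hausdorff_product I (fun=> unit_interval R)) => _; exact: unit_interval_hausdorff.
Qed.

Lemma coord_val_continuous (I : eqType) (i : I) :
  continuous (fun x : cube R I => set_val (x i) : R).
Proof.
move=> x; apply: (@continuous_comp _ _ _ (fun x : cube R I => x i) set_val).
  exact: (@proj_continuous I (fun=> unit_interval R)).
exact: set_val_continuous.
Qed.

Lemma continuous_to_cube (I : Type) (X : topologicalType) (f : X -> cube R I) :
  (forall i, continuous (fun x => f x i)) -> continuous f.
Proof.
move=> cf x; apply/cvg_sup => i U [_ [[W oW <-] Wx] WU].
apply: filterS WU _; apply: cf; exact: open_nbhs_nbhs.
Qed.

Lemma poincare_miranda_cube (I : choiceType) (A B : I -> set (cube R I)) :
  (forall j, closed (A j)) -> (forall j, closed (B j)) ->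
  (forall j x, A j x \/ B j x) ->
  (forall j x, set_val (x j) = 0 -> B j x) ->
  (forall j x, set_val (x j) = 1 -> A j x) ->
  exists x, forall j, A j x /\ B j x.
Proof.
move=> clA clB AB B0 A1.
apply: (@compact_fip _ I (fun j => A j `&` B j)); first exact: cube_compact.
  by move=> j; exact: closedI.
move=> J; pose s : seq I := J; pose n := size s.
(* Coordinates outside [J] are set to 0. Clamping defines [phi] on all row vectors, where the
   finite-dimensional statement asks for a cover. *)
pose phi (x : 'rV[R]_n) : cube R I := fun i =>
  if insub (index i s) is Some l then clamp (x ord0 l) else clamp 0.
have phic : continuous phi.
  apply: continuous_to_cube => i; rewrite /phi; case: insubP => [l _ _|_].
    by move=> x; apply: continuous_comp; [exact: coord_continuous|exact: clamp_continuous].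
  exact: cst_continuous.
pose e (l : 'I_n) : I := tnth (in_tuple s) l.
have phie x l : phi x (e l) = clamp (x ord0 l).
  rewrite /phi /e (tnth_nth (e l)) index_uniq ?fset_uniq ?ltn_ord //.
  by rewrite (valK l).
have clpre C : closed C -> closed (phi @^-1` C).
  by apply: preimage_closed => y _; exact: phic.
have [|||||x Hx] := @poincare_miranda_rV R n (fun l => phi @^-1` A (e l)) (fun l => phi @^-1` B (e l)).
- by move=> l; exact: clpre.
- by move=> l; exact: clpre.
- by move=> l x; exact: AB.
- by move=> l x bx xl; apply: B0; rewrite phie val_clamp // xl.
- by move=> l x bx xl; apply: A1; rewrite phie val_clamp // xl.
exists (phi x) => i iJ.
have ls : (index i s < n)%N by rewrite index_mem.
have := Hx (Ordinal ls).
by have -> : e (Ordinal ls) = i by rewrite /e (tnth_nth i) /= nth_index.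
Qed.
End Cube.

(** * Perfect normality and separation of F-sigma sets *)

Lemma closed_set_val_image (X : topologicalType) (D : set X) (F : set (set_type D)) :
  closed D -> closed F -> closed (set_val @` F).
Proof.
move=> clD clF; have [W oW WF] : open (~` F) by exact: closed_openC.
have -> : set_val @` F = D `&` ~` W.
  apply/seteqP; split=> [_ [u Fu <-]|x [Dx Wx]].
    split; first exact: set_valP.
    move=> Wu; have : (set_val @^-1` W) u by [].
    by rewrite WF.
  have Dx' : x \in D by exact: mem_set.
  exists (exist _ x Dx' : set_type D) => //.
  apply: contrapT => NF.
  have : (~` F) (exist _ x Dx' : set_type D) by [].
  by rewrite -WF.
by apply: closedI => //; exact: open_closedC.
Qed.

(** The trace of [A] is a G-delta in [D], so its complement is a union of sets closed in [D], and
    these are closed in [X] because [D] is. *)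
Lemma perfectly_normal_Fsigma (X : topologicalType) (D A : set X) : closed D -> closed A ->
  perfectly_normal (set_type D) -> Fsigma (D `\` A).
Proof.
move=> clD clA [_ GD].
have clA' : closed (set_val @^-1` A : set (set_type D)).
  by apply: preimage_closed => // u _; exact: initial_continuous.
have [W oW WE] := GD _ clA'.
exists (fun n => set_val @` (~` W n)).
  by move=> n; apply: closed_set_val_image => //; exact: open_closedC.
apply/seteqP; split=> [x [Dx NA]|x [n _ [u Wu <-]]].
  pose u : set_type D := exist _ x (mem_set Dx).
  have : ~ (\bigcap_i W i) u by rewrite -WE.
  by move/existsNP => [n /not_implyP[_ Wn]]; exists n => //; exists u.
split; first exact: set_valP.
move=> Au; apply: Wu; have : (set_val @^-1` A) u by [].
by rewrite WE; apply.
Qed.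

Section Separation.
Variable X : topologicalType.
Hypothesis nX : normal_space X.

Lemma normal_shrink (K C : set X) : closed K -> closed C -> K `&` C = set0 ->
  exists Q, [/\ open Q, K `<=` Q & closure Q `&` C = set0].
Proof.
move=> clK clC KC0; have KC : set_nbhs K (~` C).
  apply/set_nbhsP; exists (~` C); split=> //; first exact: closed_openC.
  exact/disjoints_subset.
have [V /set_nbhsP[Q [oQ KQ QV]] VC] := nX clK KC.
exists Q; split=> //; apply/disjoints_subset; apply: subset_trans VC; exact: closureS.
Qed.

(** Each closed piece of one set is enlarged to an open set whose closure stays off [A], resp. [B];
    removing the closures of the earlier enlargements of the other side makes the unions
    disjoint. *)
Lemma separate_Fsigma (D A B : set X) : closed A -> closed B ->
  D `<=` A `|` B ->
  Fsigma (D `\` A) -> Fsigma (D `\` B) ->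
  exists U V, [/\ open U, open V, U `&` V = set0,
    U `&` D = D `\` A & V `&` D = D `\` B].
Proof.
move=> clA clB DAB [K clK KE] [L clL LE].
have KA n : K n `&` A = set0.
  by apply/disjoints_subset => x Kx; have [] : (D `\` A) x by rewrite KE; exists n.
have LB n : L n `&` B = set0.
  by apply/disjoints_subset => x Lx; have [] : (D `\` B) x by rewrite LE; exists n.
have [G GP] := choice (fun n => normal_shrink (clK n) clA (KA n)).
have [P PP] := choice (fun n => normal_shrink (clL n) clB (LB n)).
have clO n x : closure (G n) x -> ~ A x.
  by have [_ _ /disjoints_subset] := GP n => /[apply].
have clP n x : closure (P n) x -> ~ B x.
  by have [_ _ /disjoints_subset] := PP n => /[apply].
have oC (Q : nat -> set X) n : open (~` \bigcup_(m < n.+1) closure (Q m)).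
  apply: closed_openC; apply: closed_bigcup => *; [exact: finite_II|exact: closed_closure].
(* The bound [n.+1] includes [m = n], so for any pair of indices at least one of the two removals
   applies. *)
exists (\bigcup_n (G n `&` ~` \bigcup_(m < n.+1) closure (P m))),
  (\bigcup_n (P n `&` ~` \bigcup_(m < n.+1) closure (G m))); split.
- by apply: bigcup_open => n _; apply: openI => //; case: (GP n).
- by apply: bigcup_open => n _; apply: openI => //; case: (PP n).
- apply/disjoints_subset => x [n _ [On NP]] [m _ [Pm NO]].
  have [nm|mn] := leqP n m.
    by apply: NO; exists n => //; exact: subset_closure.
  by apply: NP; exists m; [exact: ltnW | exact: subset_closure].
- apply/seteqP; split=> [x [[n _ [On _]] Dx]|x DAx].
    by split=> //; apply: (clO n); exact: subset_closure.
  split; last by case: DAx.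
  have [n _ Kn] : (\bigcup_i K i) x by rewrite -KE.
  exists n => //; split; first by case: (GP n) => _ /(_ _ Kn).
  by move=> [m _ Pm]; case: DAx => /DAB[//|Bx] _; case: (clP m x).
- apply/seteqP; split=> [x [[n _ [On _]] Dx]|x DBx].
    by split=> //; apply: (clP n); exact: subset_closure.
  split; last by case: DBx.
  have [n _ Ln] : (\bigcup_i L i) x by rewrite -LE.
  exists n => //; split; first by case: (PP n) => _ /(_ _ Ln).
  by move=> [m _ Om]; case: DBx => /DAB[Ax|//] _; case: (clO m x).
Qed.
End Separation.

(** * Closed sets attached to an upper semicontinuous map *)

Lemma usc_Dom_closed (E1 E2 : topologicalType) (T : E1 -> set E2) :
  upper_semicontinuous T -> closed (Dom T).
Proof.
move=> uscT x clx; apply/set0P/negP => /eqP Tx0.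
have := uscT x set0 open0; rewrite Tx0 => /(_ (@subset_refl _ _)) /clx.
by move=> [y [[t Tt] /(_ _ Tt)]].
Qed.

Section Sides.
Variables (R : realType) (I : eqType) (i : I) (T : cube R I -> set (unit_interval R)).

(** The signs [1] and [-1] give the points with a value below, resp. above, their coordinate [i]. *)
Definition side (s : R) : set (cube R I) :=
  [set x | exists2 t, T x t & s * set_val t <= s * set_val (x i)].

Lemma side_closed (s : R) : s != 0 -> upper_semicontinuous T ->
  (forall x, closed (T x)) -> closed (side s).
Proof.
move=> s0 uscT clT x clx; apply: contrapT => Nx.
pose y := x i.
have NTy : ~ T x y by move=> Ty; apply: Nx; exists y.
have ny : nbhs y (~` T x) by apply: open_nbhs_nbhs; split => //; exact: closed_openC.
have [W [oW yW] WT] : exists2 W : set R, open W /\ W (set_val y) &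
    forall t : unit_interval R, W (set_val t) -> ~ T x t.
  have [_ [[W oW <-] Wy] WT] := ny.
  by exists W => // t Wt; apply: WT.
have /nbhs_ballP[e /= e0 eW] := open_nbhs_nbhs (conj oW yW).
(* Outside [side s], every value lies strictly beyond [y] in direction [s], and at distance at least
   [e]; halving [e] keeps the inequality strict. *)
have far t : T x t -> s * set_val t > s * set_val y + `|s| * e / 2.
  move=> Tt; have sgt : s * set_val t > s * set_val y.
    by rewrite ltNge; apply/negP => le; apply: Nx; exists t.
  have : e <= `|set_val y - set_val t|.
    by rewrite leNgt; apply/negP => lt; apply: (WT t) => //; exact: eW.
  rewrite distrC -(ler_pM2l (_ : 0 < `|s|)) ?normr_gt0 // -normrM mulrBr.
  rewrite gtr0_norm ?subr_gt0 // lerBrDl => /(lt_le_trans _); apply.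
  have : 0 < `|s| * e by rewrite mulr_gt0 ?normr_gt0.
  by lra.
(* A threshold between [y] and the values at [x]: near [x], the values stay beyond it by upper
   semicontinuity and the coordinate before it by continuity. *)
pose c := s * set_val y + `|s| * e / 2.
have sc : continuous (fun t : unit_interval R => s * set_val t).
  move=> t; apply: (@continuous_comp _ _ _ set_val ( *%R s)); last exact: mulrl_continuous.
  exact: set_val_continuous.
have n1 : \forall x' \near x, T x' `<=` [set t | s * set_val t > c].
  apply: uscT far.
  by apply: (@open_comp _ _ (fun t : unit_interval R => s * set_val t) [set r | r > c]) => // *; exact: sc.
have n2 : \forall x' \near x, s * set_val (x' i) < c.
  have cc : {for x, continuous (fun x' : cube R I => s * set_val (x' i))}.
    apply: (@continuous_comp _ _ _ (fun x' : cube R I => set_val (x' i) : R) ( *%R s)).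
      exact: coord_val_continuous.
    exact: mulrl_continuous.
  apply: (cvgr_lt _ cc).
  by rewrite /c ltrDl divr_gt0 // mulr_gt0 // normr_gt0 //.
have [z [[t Tt le] [/(_ _ Tt) /= lt1 lt2]]] := clx _ (filterI n1 n2).
by have := lt_le_trans (lt_trans lt2 lt1) le; rewrite ltxx.
Qed.
End Sides.

(** * Convex values and the choice of the point *)

Lemma convex_between (R : realType) (A : set (unit_interval R)) (t u w : unit_interval R) :
  convex_in_unit_interval A -> A t -> A u ->
  set_val t <= set_val w -> set_val w <= set_val u -> A w.
Proof.
move=> cA At Au tw wu.
have [tu|] := ltP (set_val t : R) (set_val u); last first.
  move=> ut; have -> // : w = t; apply: val_inj; apply/eqP.
  by rewrite eq_le tw (le_trans wu).
have d0 : 0 < (set_val u : R) - set_val t by rewrite subr_gt0.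
(* The weight of [t] when [w] is written as a convex combination of [t] and [u]. *)
pose l : R := (set_val u - set_val w) / (set_val u - set_val t).
have l0 : 0 <= l by rewrite divr_ge0 ?subr_ge0 // ltW.
have l1 : l <= 1 by rewrite ler_pdivrMr // mul1r lerB.
have inA z : A z -> (set_val z : convex_lmodType R^o) \in set_val @` A.
  by move=> Az; apply/mem_set; exists z.
have /set_mem[z Az zE] := cA _ _ (Itv01 l0 l1) (inA _ At) (inA _ Au).
suff <- : z = w by [].
apply: val_inj; apply: (etrans zE).
change (l * set_val t + (1 - l) * set_val u = set_val w :> R).
have : l * (set_val u - set_val t) = set_val u - set_val w :> R by rewrite divfK // gt_eqF.
by lra.
Qed.

Lemma theorem2_choice (R : realType) (I : choiceType)
  (T : forall alpha : I, cube R I -> set (unit_interval R))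
  (uscT : forall alpha : I, upper_semicontinuous (T alpha))
  (valT : forall (alpha : I) (x : cube R I),
     T alpha x = set0 \/
     [/\ T alpha x !=set0, closed (T alpha x) &
         convex_in_unit_interval (T alpha x)])
  (domT : forall alpha : I, perfectly_normal (set_type (Dom (T alpha)))) :
  exists x : cube R I,
    forall alpha : I, T alpha x (x alpha) \/ T alpha x = set0.
Proof.
have clT i x : closed (T i x).
  by case: (valT i x) => [->|[]//]; exact: closed0.
pose L i := side i (T i) 1; pose M i := side i (T i) (-1).
have clL i : closed (L i) by apply: side_closed; rewrite ?oner_eq0.
have clM i : closed (M i) by apply: side_closed; rewrite ?oppr_eq0 ?oner_eq0.
have LE i x : L i x <-> exists2 t, T i x t & (set_val t : R) <= set_val (x i).
  by split=> -[t Tt le]; exists t => //; move: le; rewrite !mul1r.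
have ME i x : M i x <-> exists2 t, T i x t & (set_val (x i) : R) <= set_val t.
  by split=> -[t Tt le]; exists t => //; move: le; rewrite !mulN1r lerN2.
have DLM i : Dom (T i) `<=` L i `|` M i.
  move=> x [t Tt]; case: (lerP (set_val t : R) (set_val (x i))) => le; [left|right].
    by apply/LE; exists t.
  by apply/ME; exists t => //; exact: ltW.
have sep i : exists UV : set (cube R I) * set (cube R I),
    [/\ open UV.1, open UV.2, UV.1 `&` UV.2 = set0,
      UV.1 `&` Dom (T i) = Dom (T i) `\` L i & UV.2 `&` Dom (T i) = Dom (T i) `\` M i].
  have clD := usc_Dom_closed (uscT i).
  have [] := separate_Fsigma (@cube_normal R I) (clL i) (clM i) (DLM i).
  - exact: perfectly_normal_Fsigma.
  - exact: perfectly_normal_Fsigma.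
  by move=> U [V UV]; exists (U, V).
have [UV UVP] := choice sep.
have level (r : R) i : closed [set x : cube R I | set_val (x i) = r].
  apply: (@preimage_closed _ _ (fun x : cube R I => set_val (x i) : R) [set r]).
    by move=> x _; exact: coord_val_continuous.
  exact: closed_eq.
(* Adding the faces makes the boundary conditions immediate. It does no harm: on the domain, any
   value lies below a coordinate equal to 1 and above one equal to 0. *)
have [|||||x Hx] := @poincare_miranda_cube R I
    (fun i => ~` (UV i).1 `|` [set x | set_val (x i) = 1])
    (fun i => ~` (UV i).2 `|` [set x | set_val (x i) = 0]).
- by move=> i; apply: closedU => //; apply: open_closedC; case: (UVP i).
- by move=> i; apply: closedU => //; apply: open_closedC; case: (UVP i).
- move=> i x; have [Ux|Ux] := pselect ((UV i).1 x); last by left; left.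
  right; left => Vx; have [_ _ E _ _] := UVP i.
  by have : ((UV i).1 `&` (UV i).2) x by []; rewrite E.
- by move=> i x xi; right.
- by move=> i x xi; right.
exists x => i; have [T0|/set0P Dx] := eqVneq (T i x) set0; [by right|left].
have [_ _ _ UL VM] := UVP i; have [Ax Bx] := Hx i.
have [t Tt tx] : exists2 t, T i x t & (set_val t : R) <= set_val (x i).
  apply/LE; case: Ax => [Ux|x1].
    apply: contrapT => NL; apply: Ux.
    by have : (Dom (T i) `\` L i) x by []; rewrite -UL => -[].
  case: Dx => t Tt; apply/LE; exists t => //; rewrite x1.
  by case/andP: (unit_intervalP t).
have [u Tu xu] : exists2 u, T i x u & (set_val (x i) : R) <= set_val u.
  apply/ME; case: Bx => [Vx|x0].
    apply: contrapT => NM; apply: Vx.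
    by have : (Dom (T i) `\` M i) x by []; rewrite -VM => -[].
  case: Dx => u Tu; apply/ME; exists u => //; rewrite x0.
  by case/andP: (unit_intervalP u).
have cT : convex_in_unit_interval (T i x).
  by case: (valT i x) => [T0|[]//]; move: Tt; rewrite T0.
exact: convex_between cT Tt Tu tx xu.
Qed.

Theorem theorem2 (R : realType) (I : Type)
  (T : forall alpha : I, cube R I -> set (unit_interval R))
  (uscT : forall alpha : I, upper_semicontinuous (T alpha))
  (valT : forall (alpha : I) (x : cube R I),
     T alpha x = set0 \/
     [/\ T alpha x !=set0, closed (T alpha x) &
         convex_in_unit_interval (T alpha x)])
  (domT : forall alpha : I, perfectly_normal (set_type (Dom (T alpha)))) :
  exists x : cube R I,
    forall alpha : I, T alpha x (x alpha) \/ T alpha x = set0.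
Proof.
(* [{classic I}] is [I] with the choice structure that classical logic puts on any type. *)
exact: (@theorem2_choice R {classic I} T uscT valT domT).
Qed.
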